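(* Let $0<q<1$, let $I$ be an open interval, and let $p(x), r(x)$ be continuous functions on $I$. Let $y(x)$ be a solution on $I$ of $$\frac1q D_{q^{-1}}D_q y(x)+p(x)D_{q}y(x)+r(x)y(x)=0,$$ and let $F(x)$ be a solution on $I$ of $$D_{q}F(x)=p(x)F(x).$$ Let $u(x)$ be a continuous function on $I$ and let $k(x)$ be an arbitrary function satisfying $D_{q^{-1}}k(x)=u(x)k(x)$ for $x\in I$. Then $$\int F(x)\,k(qx)\Big(D_{q}u(x)+u(x)u(qx)+\tilde A(x)u(qx)+r(x)\Big)y(x)\,d_qx = F(x)\,k(x)\Big(y(x)u(x)-D_{q^{-1}}y(x)\Big),$$ where $$\tilde A(x)=p(x)+x(1-q)r(x).$$
   Context: For $x\neq0$, $D_qf(x)=\dfrac{f(x)-f(qx)}{(1-q)x}$ and $D_{q^{-1}}f(x)=\dfrac{f(x)-f(x/q)}{(1-q^{-1})x}$. The indefinite $q$-integral $\int \Phi(x)\,d_qx=G(x)$ means $D_qG(x)=\Phi(x)$. All functions are understood to be defined, and the equations to hold, at the points among $x, qx, x/q$ that occur in the formulas. *)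

(* Defs.v *)
From HB Require Import structures.
From mathcomp Require Import all_boot all_order all_algebra.
From mathcomp Require Import all_classical all_reals all_analysis.
Set Implicit Arguments.
Unset Strict Implicit.
Unset Printing Implicit Defensive.
Import Order.TTheory GRing.Theory Num.Theory.
Import numFieldNormedType.Exports.
Local Open Scope classical_set_scope.
Local Open Scope ring_scope.

(* The q-difference quotient; [qD q^-1] is D_{q^{-1}}, since q^-1 * x = x / q.
   It is meaningful only for x != 0 (at 0 it is the junk value 0), so every
   equation involving it has to be restricted to x != 0. *)
Definition qD (R : realType) (q : R) (f : R -> R) (x : R) : R :=
  (f x - f (q * x)) / ((1 - q) * x).

(* The indefinite q-integral: \int Phi(x) d_q x = G(x) on the set I. *)
Definition is_qint (R : realType) (q : R) (I : set R) (Phi G : R -> R) : Prop :=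
  forall x : R, I x -> x != 0 -> qD q G x = Phi x.

(* Main.v *)
(* The q-analogue of integrating by parts. With a = (1 - q) x and
   d = D_q y(x), the hypotheses read
     F(qx) = (1 - a p) F(x),          k(x) = (1 + a u(qx)) k(qx),
     y(qx) = y(x) - a d,              D_{1/q} y(x) = d - a (p d + r y(x)),
   and D_{1/q} y(qx) = d. Substituting these into the difference quotient of
   the right-hand side leaves F(x) k(qx) times an expression linear in y(x)
   and d, in which the coefficient of d cancels. *)
Require Import Defs.
From HB Require Import structures.
From mathcomp Require Import all_boot all_order all_algebra.
From mathcomp Require Import all_classical all_reals all_analysis.
From mathcomp Require Import ring.
Set Implicit Arguments.
Unset Strict Implicit.
Unset Printing Implicit Defensive.
Import Order.TTheory GRing.Theory Num.Theory.
Import numFieldNormedType.Exports.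
Local Open Scope classical_set_scope.
Local Open Scope ring_scope.

Lemma qD_shift (R : realType) (q : R) (f : R -> R) (x : R) :
  q != 1 -> x != 0 -> f (q * x) = f x - (1 - q) * x * qD q f x.
Proof.
move=> q1 x0; rewrite /qD [X in _ - X]mulrC divfK ?subKr //.
by rewrite mulf_neq0 // subr_eq0 eq_sym.
Qed.

(** Both quotients compare the points [x] and [q * x]; numerator and denominator each change
    sign. *)
Lemma qD_inv_scale (R : realType) (q : R) (f : R -> R) (x : R) :
  q != 0 -> qD q^-1 f (q * x) = qD q f x.
Proof.
move=> q0; rewrite /qD mulKf //.
have -> : (1 - q^-1) * (q * x) = - ((1 - q) * x) by field.
by rewrite invrN mulrN -mulNr opprB.
Qed.

(* The functions are total on R, hence defined at q x and x / q for x in I.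
   The equation for k is assumed at x and at q x for x in I: k (q x) and
   u (q x) occur in the conclusion, and q x need not belong to I. *)
Theorem theorem2p2 (R : realType) (q : R) (I : set R) (p r y F u k : R -> R)
  (q_gt0 : 0 < q) (q_lt1 : q < 1)
  (I_open : open I) (I_itv : is_interval I)
  (p_cont : {within I, continuous p})
  (r_cont : {within I, continuous r})
  (y_sol : forall x : R, I x -> x != 0 ->
     q^-1 * qD q^-1 (qD q y) x + p x * qD q y x + r x * y x = 0)
  (F_sol : forall x : R, I x -> x != 0 -> qD q F x = p x * F x)
  (u_cont : {within I, continuous u})
  (k_sol : forall x : R, I x -> x != 0 ->
     qD q^-1 k x = u x * k x /\
     qD q^-1 k (q * x) = u (q * x) * k (q * x)) :
  let A (x : R) : R := p x + x * (1 - q) * r x in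
  is_qint q I
    (fun x => F x * k (q * x) *
       (qD q u x + u x * u (q * x) + A x * u (q * x) + r x) * y x)
    (fun x => F x * k x * (y x * u x - qD q^-1 y x)).
Proof.
move=> A x Ix x0.
have q0 : q != 0 by rewrite gt_eqF.
have q1 : q != 1 by rewrite lt_eqF.
have q1' : 1 - q != 0 by rewrite subr_eq0 eq_sym.
have Fq : F (q * x) = F x - (1 - q) * x * (p x * F x).
  by rewrite qD_shift // F_sol.
have kx : k x = k (q * x) + (1 - q) * x * (u (q * x) * k (q * x)).
  have [_ <-] := k_sol x Ix x0.
  by rewrite qD_inv_scale // [k (q * x)]qD_shift // subrK.
have ey : qD q^-1 y x =
    qD q y x - (1 - q) * x * (p x * qD q y x + r x * y x).
  have e : qD q y (q^-1 * x) = qD q^-1 y x.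
    by rewrite -qD_inv_scale // mulVKf.
  have := y_sol x Ix x0; rewrite -addrA => /eqP.
  rewrite addrC addr_eq0 => /eqP ->.
  rewrite [qD q^-1 (qD q y) x]/qD e; field.
  by rewrite q0 x0 subr_eq0.
(* Only the outer quotient is unfolded at first, so that [qD q^-1 y (q * x)] can still be turned
   into [qD q y x]. *)
rewrite {1}/qD qD_inv_scale // Fq kx ey (qD_shift y q1 x0) /qD /A.
field.
by rewrite x0 q1'.
Qed.
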